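(* There exist two infinite sets $\mathcal{A}=\{a_n\}_{n=1}^{\infty}$ (with $a_1<a_2<\cdots$) and $\mathcal{M}$ of positive integers such that $$\lim_{n\to\infty}\frac{\log a_{n+1}-\log a_n}{\log n}=+\infty,$$ $p(n,\mathcal{A},\mathcal{M})>0$ for all sufficiently large $n$, and $p=p(n,\mathcal{A},\mathcal{M})$ has polynomial growth.
   Context: $\mathbb{N}$ is the set of positive integers. For $n\in\mathbb{N}$ and $\mathcal{A},\mathcal{M}\subseteq\mathbb{N}$, $p(n,\mathcal{A},\mathcal{M})$ denotes the number of representations of $n$ in the form $n=\sum_{a\in\mathcal{A}}m_a a$, where $m_a\in\mathcal{M}\cup\{0\}$ for all $a\in\mathcal{A}$ and only finitely many $m_a$ are nonzero (that is, the number of such families $(m_a)_{a\in\mathcal{A}}$). The function $p=p(n,\mathcal{A},\mathcal{M})$ is said to have polynomial growth if there exist a constant $c>0$ and an integer $n_0$ such that $p(n,\mathcal{A},\mathcal{M})\le n^c$ for all $n\ge n_0$. Here $\log$ is the natural logarithm. *)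

(* Defs.v *)
From mathcomp Require Import all_boot all_order all_algebra finmap.
From mathcomp Require Import all_classical all_reals all_analysis.
Import Order.TTheory GRing.Theory Num.Theory.
Import numFieldNormedType.Exports.

Set Implicit Arguments.
Unset Strict Implicit.
Unset Printing Implicit Defensive.

Local Open Scope classical_set_scope.

(* A family (m_a)_{a in A} with finitely many nonzero terms is encoded as its
   extension by zero to nat. *)
Definition reps (n : nat) (A M : set nat) : set {fsfun nat -> nat with 0} :=
  [set m : {fsfun nat -> nat with 0} | [/\ forall a, ~ A a -> m a = 0,
               forall a, A a -> (M `|` [set 0]) (m a) &
               \sum_(a <- finsupp m) m a * a = n]].

Lemma finite_reps n (A M : set nat) :
  (forall a, A a -> 0 < a) -> finite_set (reps n A M).
Proof.
move=> Apos.
have small m : reps n A M m -> forall a, m a != 0 -> a <= n /\ m a <= n.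
  move=> [mA mM mn] a ma.
  have a_gt0 : 0 < a by apply: Apos; apply: contrapT => /mA /eqP; apply/negP.
  have : m a * a <= n.
    rewrite -mn (big_rem a) ?leq_addr//.
    by rewrite mem_finsupp.
  move=> le; split; apply: leq_trans le.
    by rewrite leq_pmull// lt0n.
  by rewrite leq_pmulr.
pose f (m : {fsfun nat -> nat with 0}) : {ffun 'I_n.+1 -> 'I_n.+1} :=
  [ffun i => inord (m (val i))].
have f_inj : {in reps n A M &, injective f}.
  move=> m1 m2 /set_mem m1R /set_mem m2R /ffunP f12; apply/fsfunP => a.
  have f_val m i : reps n A M m -> f m i = m i :> nat.
    move=> mR; rewrite ffunE /= inordK// ltnS.
    by have [->//|/(small _ mR)[]] := eqVneq (m i) 0.
  have [a_le|a_gt] := leqP a n.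
    have a_lt : a < n.+1 by [].
    by have := congr1 val (f12 (Ordinal a_lt)); rewrite /= !f_val.
  have m0 m : reps n A M m -> m a = 0.
    move=> mR; apply/eqP; apply: contraLR a_gt => /(small _ mR)[].
    by rewrite -leqNgt.
  by rewrite !m0.
rewrite -(eq_finite_set (inj_card_eq f_inj)).
exact: finite_finset.
Qed.

(* [fset_set] is empty on infinite sets; by [finite_reps] this convention is
   never used when the elements of A are positive. *)
Definition p (n : nat) (A M : set nat) : nat := #|` fset_set (reps n A M)|%fset.

Definition polynomial_growth (R : realType) (f : nat -> nat) : Prop :=
  exists2 c : R, (0 < c)%R & \forall n \near \oo, ((f n)%:R <= n%:R `^ c)%R.

(* Main.v *)
Require Import Defs.
From mathcomp Require Import all_boot all_order all_algebra finmap.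
From mathcomp Require Import all_classical all_reals all_analysis.
From mathcomp Require Import zify.
Import Order.TTheory GRing.Theory Num.Theory.
Import numFieldNormedType.Exports.

(** Take A = {2^(i^2) : i >= 0} and M = {d 2^(j^2) : 0 < d < 4^(2j+1)}.

    Existence.  Since 4^((i+1)^2) = 4^(2i+1) 4^(i^2), every n has a mixed-radix
    expansion n = sum_i d_i 4^(i^2) with 0 <= d_i < 4^(2i+1).  Splitting each
    weight 4^(i^2) as 2^(i^2) 2^(i^2) turns this into
    n = sum_i (d_i 2^(i^2)) 2^(i^2), whose coefficients lie in M or vanish
    ([exists_reps]).  Using the square of the base as the weight is what lets M
    be sparse: the digits needed for the base 2^(i^2) are themselves spread out
    at height 2^(i^2) instead of filling an initial interval of the integers.

    Growth.  If 2^(k^2) <= n < 2^((k+1)^2), a representation of n involves only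
    the k+1 bases 2^(i^2) with i <= k, and its coefficients are at most n, hence
    among the at most (k+1) 4^(2k+1) numbers d 2^(j^2) with j <= k and
    d < 4^(2k+1).  So p(n) <= ((k+1) 4^(2k+1))^(k+1) = 2^(O(k^2)) = n^(O(1))
    ([leq_p], [p_leq_exp]).

    Gaps.  With a_n = 2^((n-1)^2), log a_(n+1) - log a_n = (2n-1) log 2, which
    dominates log n ([cvg_ln_sqpow_ratio]). *)

Local Open Scope classical_set_scope.

Lemma reps_term_leq n (A M : set nat) m a :
  reps n A M m -> m a * a <= n.
Proof.
move=> [_ _ <-]; have [ma0|ma] := eqVneq (m a) 0; first by rewrite ma0.
by rewrite (big_rem a) ?mem_finsupp// leq_addr.
Qed.

(** A representation of n is determined by its values on the bases up to n,
    and each of these values is at most n because the bases are positive.  So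
    recording the position in V of the coefficient of each entry of B is an
    injective encoding of the representations. *)
Lemma leq_p n (A M : set nat) (B V : seq nat) :
  (forall a, A a -> 0 < a) ->
  (forall a, A a -> a <= n -> a \in B) ->
  (forall v, (M `|` [set 0]) v -> v <= n -> v \in V) ->
  p n A M <= size V ^ size B.
Proof.
move=> A_gt0 AB MV.
have repsV m a : reps n A M m -> m a \in V.
  move=> mR; have [mA mM _] := mR.
  have [/[dup] Aa /A_gt0 a_gt0|nAa] := pselect (A a); last first.
    by rewrite mA//; apply: MV => //; right.
  apply: MV; first exact: mM.
  by apply: leq_trans (reps_term_leq _ _ _ _ a mR); rewrite leq_pmulr.
have repsB m a : reps n A M m -> a \notin B -> m a = 0.
  move=> mR; have [mA _ _] := mR.
  apply: contraNeq => ma; have Aa : A a by apply: contrapT => /mA/eqP; apply/negP.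
  apply: AB => //; apply: leq_trans (reps_term_leq _ _ _ _ a mR).
  by rewrite leq_pmull// lt0n.
(* V is nonempty, so its indices are the elements of 'I_(size V).-1.+1, the
   form in which inord can produce them. *)
have V_gt0 : 0 < size V.
  by rewrite -has_predT; apply/hasP; exists 0 => //; apply: MV => //; right.
pose code (m : {fsfun nat -> nat with 0}) :
    {ffun 'I_(size B) -> 'I_(size V).-1.+1} :=
  [ffun i : 'I_(size B) => inord (index (m (nth 0 B (i : nat))) V)].
have code_inj : {in fset_set (reps n A M) &, injective code}.
  move=> m1 m2; rewrite !in_fset_set ?inE; try exact: finite_reps.
  move=> m1R m2R /ffunP m12; apply/fsfunP => a.
  have [aB|aB] := boolP (a \in B); last by rewrite !repsB.
  have aB' : index a B < size B by rewrite index_mem.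
  have := congr1 val (m12 (Ordinal aB')).
  rewrite !ffunE /= nth_index// !inordK ?prednK ?index_mem ?repsV// => ii.
  by rewrite -(nth_index 0 (repsV _ a m1R)) ii nth_index ?repsV.
have code_uniq : uniq [seq code m | m <- fset_set (reps n A M)].
  by rewrite map_inj_in_uniq ?fset_uniq.
rewrite /p -(size_map code) -(card_uniqP code_uniq).
by rewrite (leq_trans (max_card _))// card_ffun !card_ord prednK.
Qed.

Lemma reps0 (A M : set nat) : reps 0 A M [fsfun].
Proof.
split=> [a _|a _|]; rewrite ?fsfunE//; first by right.
by rewrite finsupp0 big_seq_fset0.
Qed.

(** The step that adds one digit to an expansion; v = 0 is allowed because
    digits may vanish. *)
Lemma reps_with n (A M : set nat) m a v :
  reps n A M m -> A a -> m a = 0 -> (M `|` [set 0]) v ->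
  reps (v * a + n) A M [fsfun m with a |-> v].
Proof.
move=> [mA mM mn] Aa ma0 Mv; split=> [b nAb|b Ab|].
- by rewrite fsfun_withE; case: eqP => [ba|_]; [rewrite -ba in Aa|exact: mA].
- by rewrite fsfun_withE; case: eqP => // _; exact: mM.
have afm : a \notin finsupp m by rewrite memNfinsupp ma0.
(* When v = 0 the new support does not contain a, so the sum is first extended
   to a |` finsupp m, which is right in both cases. *)
rewrite (big_fset_incl _ (B := (a |` finsupp m)%fset)); last 2 first.
- rewrite finsupp_with; case: ifP => _ //.
  by rewrite (fsubset_trans (fsubD1set _ _))// fsubsetU1.
- by move=> b _; rewrite memNfinsupp => /eqP ->.
rewrite big_fsetU1//= fsfun_withE eqxx; congr addn.
rewrite -mn; apply: eq_big_seq => b bm; rewrite fsfun_withE ifN//.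
by apply: contraNneq afm => <-.
Qed.

Definition sqpow (i : nat) : nat := 2 ^ (i ^ 2).

Definition bases : set nat := range sqpow.

Definition coeffs : set nat :=
  [set x | exists j d, 0 < d < 4 ^ (2 * j + 1) /\ x = d * sqpow j].

Lemma sqpow_gt0 i : 0 < sqpow i.
Proof. by rewrite expn_gt0. Qed.

Lemma ltn_sqpow i j : (sqpow i < sqpow j) = (i < j).
Proof. by rewrite ltn_exp2l// ltn_sqr. Qed.

Lemma sqpow_inj : injective sqpow.
Proof. by move=> i j /eqP; rewrite eqn_exp2l// eqn_sqr => /eqP. Qed.

(** The ratio of consecutive digit weights 4^(i^2); it is the reason for the
    bound on d in the definition of the coefficients. *)
Lemma sqpowS_sqr i : sqpow i.+1 ^ 2 = 4 ^ (2 * i + 1) * sqpow i ^ 2.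
Proof.
rewrite /sqpow (_ : 4 = 2 ^ 2)// -!expnM -expnD; congr expn; nia.
Qed.

Lemma ltn_sqpow_id i : i < sqpow i.
Proof.
apply: leq_trans (ltn_expl i (isT : 1 < 2)) _.
by rewrite leq_exp2l//; nia.
Qed.

Lemma exists_sqpow n : 0 < n -> exists k, sqpow k <= n < sqpow k.+1.
Proof.
move=> n_gt0; have exP : exists k, sqpow k <= n by exists 0.
have ubP k : sqpow k <= n -> k <= n.
  apply: contraLR; rewrite -!ltnNge => nk; apply: ltn_trans nk _.
  exact: ltn_sqpow_id.
have [k kn kmax] := ex_maxnP exP ubP.
by exists k; rewrite kn /= ltnNge; apply/negP => /kmax; rewrite ltnn.
Qed.

(** Induction on the number of digits: Euclidean division by 4^(k^2) splits off
    the top digit d, and d 4^(k^2) = (d 2^(k^2)) 2^(k^2) is one admissible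
    coefficient on the base 2^(k^2).  The vanishing clause keeps that base free
    for it. *)
Lemma exists_reps k n : n < sqpow k ^ 2 ->
  exists2 m, reps n bases coeffs m & forall i, k <= i -> m (sqpow i) = 0.
Proof.
elim: k n => [n|k IHk n n_lt].
  rewrite ltnS leqn0 => /eqP ->; exists [fsfun]; first exact: reps0.
  by move=> i _; rewrite fsfunE.
have s_gt0 : 0 < sqpow k ^ 2 by rewrite expn_gt0 sqpow_gt0.
have [m mR m0] := IHk (n %% sqpow k ^ 2) (ltn_pmod _ s_gt0).
set d := n %/ sqpow k ^ 2.
exists [fsfun m with sqpow k |-> d * sqpow k].
  rewrite (divn_eq n (sqpow k ^ 2)) -mulnn mulnA -/d; apply: reps_with => //.
  - by exists k.
  - exact: m0.
  - have [->|d_gt0] := posnP d; first by right.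
    by left; exists k, d; rewrite d_gt0 ltn_divLR// -sqpowS_sqr.
move=> i ki; rewrite fsfun_withE ifN ?m0 1?ltnW//.
by apply: contraTneq ki => /sqpow_inj ->; rewrite ltnn.
Qed.

Lemma p_gt0 n : 0 < p n bases coeffs.
Proof.
have n_lt : n < sqpow n ^ 2.
  by rewrite -mulnn (leq_trans (ltn_sqpow_id n))// leq_pmulr// sqpow_gt0.
have [m mR _] := exists_reps _ _ n_lt.
rewrite /p cardfs_gt0; apply/fset0Pn; exists m.
rewrite in_fset_set ?inE//; apply: finite_reps => _ [i _ <-]; exact: sqpow_gt0.
Qed.

(** With 2^(k^2) <= n < 2^((k+1)^2) and k + 1 <= 2^k, the encoding bound is at
    most 2^((5k+2)(k+1)), and (5k+2)(k+1) <= 14 k^2 as soon as k >= 1. *)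
Lemma p_leq_exp n : 1 < n -> p n bases coeffs <= n ^ 14.
Proof.
move=> n_gt1; have [k /andP[kn nk]] := exists_sqpow _ (ltnW n_gt1).
have k_gt0 : 0 < k.
  by rewrite -(ltn_add2r 1) !addn1 -ltn_sqpow (leq_trans _ nk)//; case: n n_gt1 {kn nk} => [|[]].
pose B := [seq sqpow i | i <- iota 0 k.+1].
pose V := [seq d * sqpow j | j <- iota 0 k.+1, d <- iota 0 (4 ^ (2 * k + 1))].
have := leq_p n bases coeffs B V; rewrite size_allpairs size_map !size_iota.
move=> pn; apply: (leq_trans (pn _ _ _)) => [_ [i _ <-]|_ [i _ <-] i_le|v Mv v_le|].
- exact: sqpow_gt0.
- apply: map_f; rewrite mem_iota /= add0n.
  by rewrite -ltn_sqpow (leq_ltn_trans i_le).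
- case: Mv => [[j [d [/andP[d_gt0 d_lt] v_eq]]]|->]; last first.
    apply/allpairsP; exists (0, 0); split=> //.
    by rewrite mem_iota /= expn_gt0.
  have jk : j < k.+1.
    rewrite -ltn_sqpow; apply: leq_ltn_trans nk; apply: leq_trans v_le.
    by rewrite v_eq leq_pmull.
  rewrite v_eq; apply: allpairs_f; rewrite mem_iota //= add0n.
  by rewrite (leq_trans d_lt)// leq_exp2l// leq_add2r leq_mul2l.
apply: (@leq_trans (sqpow k ^ 14)); last by rewrite leq_exp2r.
apply: (@leq_trans ((2 ^ k * 4 ^ (2 * k + 1)) ^ k.+1)).
  by rewrite leq_exp2r// leq_mul2r ltn_expl// orbT.
rewrite /sqpow (_ : 4 = 2 ^ 2)// -!expnM -expnD -expnM leq_exp2l//.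
nia.
Qed.

Lemma infinite_bases : infinite_set bases.
Proof.
rewrite (eq_finite_set (inj_card_eq _)); first exact: infinite_nat.
by move=> i j _ _; exact: sqpow_inj.
Qed.

Lemma bases_sub_coeffs : bases `<=` coeffs.
Proof.
move=> _ [i _ <-]; exists i, 1; split; last by rewrite mul1n.
by rewrite addn1 expnS; have := expn_gt0 4 (2 * i); lia.
Qed.

Local Open Scope ring_scope.

Lemma ln_sqpow (R : realType) i : ln (sqpow i)%:R = (i ^ 2)%:R * ln 2 :> R.
Proof. by rewrite /sqpow natrX lnXn// mulr_natl. Qed.

Lemma ln_leq_sqrt (R : realType) (x : R) : 0 < x -> ln x <= 2 * Num.sqrt x.
Proof.
move=> x_gt0; rewrite -{1}(sqr_sqrtr (ltW x_gt0)) lnXn ?sqrtr_gt0//.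
by rewrite mulr_natl lerMn2r /= ltW// ln_sublinear// sqrtr_gt0.
Qed.

(** The numerator is at least n ln 2 and the denominator at most 2 sqrt n, so
    the ratio is at least C once sqrt n >= 2 |C| / ln 2. *)
Lemma cvg_ln_sqpow_ratio (R : realType) :
  (fun n : nat => (ln (sqpow n)%:R - ln (sqpow n.-1)%:R) / ln n%:R : R) @ \oo
    --> +oo.
Proof.
have ln2_gt0 : 0 < ln 2 :> R by rewrite ln_gt0// ltr1n.
apply/cvgryPge => C.
near=> n.
have n_gt1 : (1 < n)%N by near: n; exact: nbhs_infty_gt.
have n_gt0 : 0 < n%:R :> R by rewrite ltr0n ltnW.
have ln_gt0 : 0 < ln n%:R :> R by rewrite ln_gt0// ltr1n.
have sqrtn_gt0 : 0 < Num.sqrt n%:R :> R by rewrite sqrtr_gt0.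
have Cn : (2 * `|C| / ln 2) ^+ 2 <= n%:R by near: n; exact: nbhs_infty_ger.
have {}Cn : 2 * `|C| / ln 2 <= Num.sqrt n%:R :> R.
  have C_ge0 : 0 <= 2 * `|C| / ln 2 by rewrite !mulr_ge0// invr_ge0 ltW.
  by rewrite -[leLHS]ger0_norm// -sqrtr_sqr ler_wsqrtr.
rewrite !ln_sqpow -mulrBl -natrB; last by rewrite leq_sqr leq_pred.
rewrite ler_pdivlMr// (le_trans (ler_wpM2r (ltW ln_gt0) (ler_norm C)))//.
rewrite (le_trans (ler_wpM2l (normr_ge0 C) (ln_leq_sqrt _ _ n_gt0)))//.
apply: (@le_trans _ _ (n%:R * ln 2)); last first.
  rewrite ler_pM2r// ler_nat.
  by move: n_gt1; clear; case: n => // n _ /=; nia.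
rewrite -[in leRHS](sqr_sqrtr (ltW n_gt0)) expr2 [leRHS]mulrAC mulrA.
by rewrite ler_pM2r// -ler_pdivrMr// (mulrC _ 2).
Unshelve. all: by end_near.
Qed.

Theorem corollary1 (R : realType) :
  exists (A M : set nat) (a : nat -> nat),
    [/\ infinite_set A /\ (forall x : nat, A x -> (0 < x)%N),
        infinite_set M /\ (forall x : nat, M x -> (0 < x)%N),
        A = [set a n | n in [set n : nat | (1 <= n)%N]] /\
          (forall i j : nat, (1 <= i)%N -> (i < j)%N -> (a i < a j)%N),
        (fun n : nat => (ln (a n.+1)%:R - ln (a n)%:R) / ln n%:R : R) @ \oo
          --> +oo &
        (\forall n \near \oo, (0 < p n A M)%N) /\
          polynomial_growth R (fun n => p n A M)].
Proof.
exists bases, coeffs, (fun n => sqpow n.-1); split.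
- by split; [exact: infinite_bases | move=> _ [i _ <-]; exact: sqpow_gt0].
- split; first exact: sub_infinite_set bases_sub_coeffs infinite_bases.
  by move=> _ [j [d [/andP[d_gt0 _] ->]]]; rewrite muln_gt0 d_gt0 sqpow_gt0.
- split; last by move=> [|i] [|j] // _ ij; rewrite ltn_sqpow.
  apply/seteqP; split=> [_ [i _ <-]|_ [[|i]] // _ <-]; last by exists i.
  by exists i.+1.
- exact: cvg_ln_sqpow_ratio.
- split; first by apply: nearW => n; exact: p_gt0.
  exists 14%:R => //; near=> n.
  rewrite powR_mulrn// -natrX ler_nat p_leq_exp//.
  by near: n; exact: nbhs_infty_gt.
Unshelve. all: by end_near.
Qed.
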